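(* There is an algorithm that, for any even non-degenerate lattice $\mathcal{L}$, computes an even, positive definite lattice $\mathcal{L}'$ such that $\mathcal{L}\oplus\mathcal{U}_1\cong\mathcal{L}'\oplus\mathcal{U}_2$ for suitable unimodular lattices $\mathcal{U}_1$ and $\mathcal{U}_2$.
   Context: A lattice is a free $\mathbb{Z}$-module of finite rank with a non-degenerate symmetric $\mathbb{Z}$-valued bilinear form; it is even if $\langle v,v\rangle\in 2\mathbb{Z}$ for all $v$, and unimodular if it equals its dual lattice. $\oplus$ denotes orthogonal direct sum and $\cong$ isometry. *)

(* Defs.v *)
From mathcomp Require Import all_boot all_order all_algebra.
Set Implicit Arguments. Unset Strict Implicit. Unset Printing Implicit Defensive.
Import Order.TTheory GRing.Theory Num.Theory.
Local Open Scope ring_scope.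

(* A lattice of rank n is Z^n (row vectors) with the bilinear form
   <u,v> = u *m G *m v^T given by an integer Gram matrix G. *)

Definition bform n (G : 'M[int]_n) (u v : 'rV[int]_n) : int := (u *m G *m v^T) 0 0.

Definition symmetric_gram n (G : 'M[int]_n) : Prop := G^T = G.

Definition nondegenerate n (G : 'M[int]_n) : Prop := \det G != 0.

Definition is_lattice n (G : 'M[int]_n) : Prop :=
  symmetric_gram G /\ nondegenerate G.

Definition even_lattice n (G : 'M[int]_n) : Prop :=
  forall v : 'rV[int]_n, (2 %| bform G v v)%Z.

Definition pos_def n (G : 'M[int]_n) : Prop :=
  forall v : 'rV[int]_n, v != 0 -> 0 < bform G v v.

Definition is_intQ (x : rat) : Prop := exists z : int, x = z%:~R.

Definition in_dual n (G : 'M[int]_n) (x : 'rV[rat]_n) : Prop :=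
  forall v : 'rV[int]_n,
    is_intQ ((x *m map_mx (fun z : int => z%:~R) G *m (map_mx (fun z : int => z%:~R) v)^T) 0 0).

Definition in_lattice n (x : 'rV[rat]_n) : Prop :=
  forall i, is_intQ (x 0 i).

(* unimodular: L equals its dual lattice (L subset L^# always holds) *)
Definition unimodular n (G : 'M[int]_n) : Prop :=
  forall x : 'rV[rat]_n, in_dual G x <-> in_lattice x.

Definition osum m n (G1 : 'M[int]_m) (G2 : 'M[int]_n) : 'M[int]_(m + n) :=
  block_mx G1 0 0 G2.

Definition isometric m n (G1 : 'M[int]_m) (G2 : 'M[int]_n) : Prop :=
  exists (P : 'M[int]_(m, n)) (Q : 'M[int]_(n, m)),
    [/\ P *m Q = 1%:M, Q *m P = 1%:M & P^T *m G1 *m P = G2].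

(* Main.v *)
(** Negative directions are removed one at a time.  Let [u] be a vector of [L] with
    [<u,u> = -D < 0], let [k = 4D - 2], and put [c = (2u, 1, ..., 1)] in [M = L + Z^k], so
    that [<c,c> = -2].  In [M + <1>] the vector [(c, 1)] has norm -1, hence it splits off,
    and its orthogonal complement consists of the vectors [(y, -<c,y>)], i.e. it is [M]
    with the quadratic form [<y,y> + <c,y>^2].  The factor 2 in [2u] makes this form even when
    [L] is, and Cauchy-Schwarz shows that the negative index drops by one.  Starting
    from an orthogonal diagonalization of [L] over the rationals, with cleared
    denominators, the process ends in a positive definite lattice. *)
Require Import Defs.
From mathcomp Require Import all_boot all_order all_algebra.
From mathcomp Require Import perm.
From mathcomp Require Import ring zify.
Import Order.TTheory GRing.Theory Num.Theory.
Local Open Scope ring_scope.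

Set Implicit Arguments.
Unset Strict Implicit.
Unset Printing Implicit Defensive.

(** * Isometries and orthogonal sums *)

Lemma isometric_refl n (G : 'M[int]_n) : isometric G G.
Proof. by exists 1%:M, 1%:M; rewrite trmx1 !mul1mx mulmx1. Qed.

Lemma isometric_sym m n (G : 'M[int]_m) (H : 'M[int]_n) :
  isometric G H -> isometric H G.
Proof.
move=> [P [Q [PQ QP <-]]]; exists Q, P; split => //.
by rewrite !mulmxA -trmx_mul PQ trmx1 mul1mx -mulmxA PQ mulmx1.
Qed.

Lemma isometric_trans m n p (G : 'M[int]_m) (H : 'M[int]_n) (K : 'M[int]_p) :
  isometric G H -> isometric H K -> isometric G K.
Proof.
move=> [P [Q [PQ QP <-]]] [P' [Q' [PQ' QP' <-]]].
exists (P *m P'), (Q' *m Q); split; last by rewrite trmx_mul !mulmxA.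
- by rewrite mulmxA -(mulmxA P) PQ' mulmx1.
- by rewrite mulmxA -(mulmxA Q') QP mulmx1.
Qed.

Lemma isometric_osum m n p q (G : 'M[int]_m) (H : 'M[int]_n)
    (K : 'M[int]_p) (L : 'M[int]_q) :
  isometric G H -> isometric K L -> isometric (osum G K) (osum H L).
Proof.
move=> [P [Q [PQ QP <-]]] [P' [Q' [PQ' QP' <-]]].
exists (block_mx P 0 0 P'), (block_mx Q 0 0 Q').
rewrite /osum tr_block_mx !mulmx_block !trmx0.
rewrite !(mulmx0, mul0mx, addr0, add0r) PQ QP PQ' QP' -!scalar_mx_block.
by split.
Qed.

Lemma isometric_osumC m n (G : 'M[int]_m) (H : 'M[int]_n) :
  isometric (osum G H) (osum H G).
Proof.
exists (block_mx 0 1%:M 1%:M 0), (block_mx 0 1%:M 1%:M 0).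
rewrite /osum tr_block_mx !mulmx_block !trmx0 !trmx1.
rewrite !(mulmx0, mul0mx, mulmx1, mul1mx, addr0, add0r) -!scalar_mx_block.
by split.
Qed.

Lemma isometric_cast m n (e : m = n) (G : 'M[int]_m) :
  isometric G (castmx (e, e) G).
Proof. by case: n / e; rewrite castmx_id; apply: isometric_refl. Qed.

Lemma isometric_osumA m n p (G : 'M[int]_m) (H : 'M[int]_n) (K : 'M[int]_p) :
  isometric (osum (osum G H) K) (osum G (osum H K)).
Proof.
have := block_mxAx G 0 0 0 H 0 0 0 K.
by rewrite /= !row_mx0 !col_mx0 /osum => ->; apply: isometric_cast.
Qed.

(** * Unimodular lattices and stable isometry *)

Lemma unitmx_unimodular n (G : 'M[int]_n) : G \in unitmx -> unimodular G.
Proof.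
move=> uG x; rewrite /in_dual.
change (fun z : int => z%:~R : rat) with (intr : int -> rat).
split=> [dx i | xZ v].
  (* Pairing [x] with the integral vector [G^-1 e_i] reads off its [i]-th coordinate. *)
  have := dx (invmx G *m delta_mx i (0 : 'I_1))^T.
  rewrite map_trmx trmxK -mulmxA -map_mxM mulmxA mulmxV // mul1mx.
  by rewrite map_delta_mx -colE mxE.
rewrite -mulmxA map_trmx -map_mxM mxE; apply: big_ind.
- by exists 0.
- by move=> _ _ [a ->] [b ->]; exists (a + b); rewrite intrD.
- by move=> k _; have [a ->] := xZ k; rewrite mxE -intrM; eexists.
Qed.

(** Unimodularity is encoded as invertibility of a symmetric Gram matrix, which passes directly to
    orthogonal sums; [unitmx_unimodular] translates it back. *)
Definition stably_isometric m n (G : 'M[int]_m) (H : 'M[int]_n) : Prop :=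
  exists (k1 : nat) (U1 : 'M[int]_k1) (k2 : nat) (U2 : 'M[int]_k2),
    [/\ U1^T = U1, U1 \in unitmx, U2^T = U2, U2 \in unitmx
      & isometric (osum G U1) (osum H U2)].

Lemma osum_unitmx m n (G : 'M[int]_m) (H : 'M[int]_n) :
  G \in unitmx -> H \in unitmx -> osum G H \in unitmx.
Proof. by rewrite !unitmxE det_ublock unitrM => -> ->. Qed.

Lemma osum_tr m n (G : 'M[int]_m) (H : 'M[int]_n) :
  (osum G H)^T = osum G^T H^T.
Proof. by rewrite /osum tr_block_mx !trmx0. Qed.

Lemma stably_isometric_refl n (G : 'M[int]_n) : stably_isometric G G.
Proof.
exists 0%N, 1%:M, 0%N, 1%:M; rewrite trmx1 unitmx1; split=> //.
exact: isometric_refl.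
Qed.

(** Adding [V1] to the first isometry and [U2] to the second makes them meet in [H + U2 + V1], up to
    order of the summands. *)
Lemma stably_isometric_trans m n p
    (G : 'M[int]_m) (H : 'M[int]_n) (K : 'M[int]_p) :
  stably_isometric G H -> stably_isometric H K -> stably_isometric G K.
Proof.
move=> [k1 [U1 [k2 [U2 [sU1 uU1 sU2 uU2 GH]]]]].
move=> [l1 [V1 [l2 [V2 [sV1 uV1 sV2 uV2 HK]]]]].
exists (k1 + l1)%N, (osum U1 V1), (l2 + k2)%N, (osum V2 U2).
rewrite !osum_tr sU1 sV1 sU2 sV2 !osum_unitmx //; split=> //.
apply: isometric_trans (isometric_osumA _ _ _).
apply: isometric_trans (isometric_osum HK (isometric_refl U2)).
apply: isometric_trans (isometric_sym (isometric_osumA _ _ _)) _.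
apply: isometric_trans (isometric_osum GH (isometric_refl V1)) _.
apply: isometric_trans (isometric_osumA _ _ _) _.
apply: isometric_trans (isometric_sym (isometric_osumA _ _ _)).
exact: isometric_osum (isometric_refl H) (isometric_osumC _ _).
Qed.

(** * Bilinear forms and the splitting of a vector of norm -1 *)

Lemma bformDl n (G : 'M[int]_n) u v w :
  bform G (u + v) w = bform G u w + bform G v w.
Proof. by rewrite /bform !mulmxDl mxE. Qed.

Lemma bformZl n (G : 'M[int]_n) a u v : bform G (a *: u) v = a * bform G u v.
Proof. by rewrite /bform -!scalemxAl mxE. Qed.

Lemma bformC n (G : 'M[int]_n) u v : G^T = G -> bform G u v = bform G v u.
Proof.
move=> sG; rewrite /bform.
by rewrite -[v *m G *m _]trmxK [RHS]mxE !trmx_mul trmxK sG mulmxA.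
Qed.

Lemma bform_osum m n (G : 'M[int]_m) (H : 'M[int]_n) u v x y :
  bform (osum G H) (row_mx u x) (row_mx v y) = bform G u v + bform H x y.
Proof.
rewrite /bform /osum mul_row_block tr_row_mx mul_row_col.
by rewrite !mulmx0 addr0 add0r mxE.
Qed.

(** For symmetric [M], this is the form of [M + <1>] on the vectors [(y, -<c,y>)]. *)
Definition add_square n (M : 'M[int]_n) (c : 'rV[int]_n) : 'M[int]_n :=
  M + (c *m M)^T *m (c *m M).

Lemma add_square_tr n (M : 'M[int]_n) c : M^T = M -> (add_square M c)^T = add_square M c.
Proof. by move=> sM; rewrite /add_square linearD /= sM trmx_mul trmxK. Qed.

Lemma bform_add_square n (M : 'M[int]_n) c u v : M^T = M ->
  bform (add_square M c) u v = bform M u v + bform M c u * bform M c v.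
Proof.
move=> sM; rewrite /bform /add_square mulmxDr mulmxDl mxE; congr (_ + _).
have -> : u *m ((c *m M)^T *m (c *m M)) *m v^T =
    (u *m M *m c^T) *m (c *m M *m v^T).
  by rewrite trmx_mul sM !mulmxA.
by rewrite mxE big_ord1 -!/(bform _ _ _) (bformC u).
Qed.

Lemma add_square_isometric n (M : 'M[int]_n) c :
  M^T = M -> bform M c c = - 2%:R ->
  isometric (osum M (1%:M : 'M_1)) (osum (add_square M c) ((-1)%:M : 'M_1)).
Proof.
move=> sM cc; set g := c *m M.
have gc : g *m c^T = (- 2%:R)%:M by rewrite [LHS]mx11_scalar -cc.
(* The columns are the vectors [(e_j, -<c,e_j>)], followed by [(c, 1)]. *)
exists (block_mx 1%:M c^T (- g) 1%:M).
(* The bottom row is the coefficient along [(c, 1)], which is minus the pairing with it because its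
   norm is -1; the top row is what remains after that multiple of [c] is subtracted. *)
exists (block_mx (1%:M + c^T *m g) c^T (- g) (- 1%:M)).
have cM : M *m c^T = g^T by rewrite /g trmx_mul sM.
have gcg : g *m c^T *m g = - g - g.
  by rewrite gc mul_scalar_mx scaleNr scaler_nat mulr2n opprD.
have cgc : c^T *m g *m c^T = - c^T - c^T.
  by rewrite -mulmxA gc mul_mx_scalar scaleNr scaler_nat mulr2n opprD.
have g1 : 1%:M + g *m c^T = - 1%:M.
  by apply/matrixP=> i j; rewrite gc !ord1 !mxE.
have g1N : - (g *m c^T) - 1%:M = 1%:M.
  by rewrite -opprD addrC g1 opprK.
split.
- rewrite mulmx_block !(mulmx1, mul1mx, mulmxN, mulNmx, mulmxDr) scalar_mx_block.
  by rewrite (mulmxA g) gcg g1N addrK !addrN opprD !opprK addKr addrN.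
- rewrite mulmx_block !(mulmx1, mul1mx, mulmxN, mulNmx, mulmxDl) scalar_mx_block.
  by rewrite cgc g1N addrK !addrN addrA addrN add0r addNr.
rewrite /osum tr_block_mx !mulmx_block !trmx1 !trmxK linearN /=.
rewrite !(mulmx0, mul0mx, mulmx1, mul1mx, addr0, add0r, mulNmx, mulmxN).
by rewrite cM -/g opprK !addrN [_ + 1%:M]addrC g1 -raddfN.
Qed.

(** * Integral diagonalization and negative frames *)

(** A nonzero diagonal entry is moved to the front. If the diagonal vanishes and [G i j] does not,
    then [e_i + e_j] has norm [2 G i j]. *)
Lemma unit_row_anisotropic n (G : 'M[int]_n.+1) : G^T = G -> G != 0 ->
  {Q : 'M[int]_n.+1 | Q \in unitmx & (Q *m G *m Q^T) 0 0 != 0}.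
Proof.
move=> sG nzG; have rE i (Q : 'M[int]_n.+1) :
    ((perm_mx (tperm 0 i) *m Q) *m G *m (perm_mx (tperm 0 i) *m Q)^T) 0 0 =
    bform G (row i Q) (row i Q).
  rewrite -row_permE.
  have -> : row i Q = row 0 (row_perm (tperm 0 i) Q).
    by apply/rowP=> j; rewrite !mxE tpermL.
  by rewrite /bform tr_row -row_mul -!row_mul !mxE; apply: eq_bigr => j _; rewrite !mxE.
have gE i j : bform G (delta_mx 0 i) (delta_mx 0 j) = G i j.
  by rewrite /bform -rowE trmx_delta -colE !mxE.
case: (pickP (fun i => G i i != 0)) => [i Gii | G0].
  exists (perm_mx (tperm 0 i) *m 1%:M); first by rewrite mulmx1 unitmx_perm.
  by rewrite rE row1 gE.
case: (pickP (fun ij => G ij.1 ij.2 != 0)) => [[i j] /= Gij | Gz]; last first.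
  by case/eqP: nzG; apply/matrixP=> i j; rewrite mxE; apply/eqP/negbFE/(Gz (i, j)).
have nij : i != j by apply: contraNneq Gij => ->; rewrite -[_ == _]negbK G0.
have tU : 1%:M + delta_mx i j \in @unitmx int n.+1.
  have : (1%:M + delta_mx i j) *m (1%:M - delta_mx i j) = 1%:M :> 'M[int]_n.+1.
    rewrite mulmxBr !mulmxDl !mul1mx mulmx1 mul_delta_mx_0 1?eq_sym //.
    by rewrite addr0 addrK.
  by case/mulmx1_unit.
exists (perm_mx (tperm 0 i) *m (1%:M + delta_mx i j)).
  by rewrite unitmx_mul unitmx_perm.
rewrite rE linearD /= row1 rowE mul_delta_mx bformDl.
rewrite !(bformC (delta_mx 0 _) (delta_mx 0 i + _) sG) !bformDl !gE.
have Gji : G j i = G i j by rewrite -{1}sG mxE.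
have /negbFE/eqP -> := G0 i; have /negbFE/eqP -> := G0 j.
by rewrite Gji add0r addr0 -mulr2n mulrn_eq0.
Qed.

(** Block elimination in which the lower rows are scaled by [a] instead of dividing by it, so that
    all entries stay integral; the transformation then has determinant [a ^+ n]. *)
Lemma schur_complement n (a : int) (b : 'rV[int]_n) (D : 'M[int]_n) :
  let P := block_mx (1%:M : 'M_1) 0 (- b^T) a%:M in
  P *m block_mx a%:M b b^T D *m P^T =
  block_mx a%:M 0 0 (a *: (a *: D - b^T *m b)).
Proof.
rewrite /= tr_block_mx !mulmx_block !trmx1 !linearN /= !tr_scalar_mx trmxK trmx0.
rewrite !(mulmx0, mul0mx, mulmx1, mul1mx, addr0, add0r, mulNmx, mulmxN).
rewrite !(mul_scalar_mx, mul_mx_scalar) !addNr mul0mx oppr0 add0r.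
by rewrite [- _ + _]addrC.
Qed.

Lemma block_mx_symmetric n (H : 'M[int]_(1 + n)) : H^T = H ->
  H = block_mx (H 0 0)%:M (ursubmx H) (ursubmx H)^T (drsubmx H).
Proof.
move=> sH; rewrite trmx_ursub sH -[LHS]submxK; congr block_mx.
by rewrite [LHS]mx11_scalar !mxE; congr (H _ _)%:M; apply: val_inj.
Qed.

(** Induction through the Schur complement. The rows of [P] may span a proper sublattice of finite
    index, which is enough for reading off signs. The existence is informative, as the algorithm
    uses the witnesses. *)
Lemma diagonalize n (G : 'M[int]_n) : G^T = G ->
  {P : 'M[int]_n & {d : 'rV[int]_n |
    \det P != 0 & P *m G *m P^T = diag_mx d}}.
Proof.
elim: n G => [|n IHn] G sG.
  exists 1%:M, 0; first by rewrite det1 oner_neq0.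
  by rewrite [LHS]flatmx0 [RHS]flatmx0.
have [->|nzG] := eqVneq G 0.
  exists 1%:M, 0; first by rewrite det1 oner_neq0.
  by rewrite mulmx0 mul0mx linear0.
have [Q uQ nz_a] := unit_row_anisotropic sG nzG.
pose H : 'M[int]_(1 + n) := Q *m G *m Q^T.
have sH : H^T = H by rewrite /H !trmx_mul trmxK sG mulmxA.
have {}nz_a : H 0 0 != 0 by [].
set a := H 0 0 in nz_a.
have EH := block_mx_symmetric sH.
have sD : (drsubmx H)^T = drsubmx H by rewrite trmx_drsub sH.
have := schur_complement a (ursubmx H) (drsubmx H).
rewrite -EH; set P1 := block_mx _ _ _ _; set D := a *: _ => /= P1H.
have [|P2 [d2 nzP2 P2D]] := IHn D.
  by rewrite /D linearZ /= linearB /= linearZ /= sD trmx_mul trmxK.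
have PE : let X := block_mx (1%:M : 'M_1) 0 0 P2 in
    X *m block_mx a%:M 0 0 D *m X^T = diag_mx (row_mx (a%:M : 'M_1) d2).
  rewrite /= tr_block_mx !mulmx_block !trmx1 !trmx0.
  rewrite !(mulmx0, mul0mx, mulmx1, mul1mx, addr0, add0r) P2D.
  rewrite diag_mx_row; congr block_mx.
  by apply/matrixP=> i j; rewrite !ord1 !mxE.
exists (block_mx (1%:M : 'M_1) 0 0 P2 *m P1 *m Q), (row_mx (a%:M : 'M_1) d2).
  have dP1 : \det P1 = a ^+ n by rewrite det_lblock det1 mul1r det_scalar.
  have dP2 : \det (block_mx (1%:M : 'M_1) 0 0 P2) = \det P2.
    by rewrite det_lblock det1 mul1r.
  rewrite !det_mulmx dP1 dP2.
  rewrite !mulf_neq0 ?expf_neq0 //.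
  by move: uQ; rewrite unitmxE; apply: contraTneq => ->; rewrite unitr0.
have -> X : X *m P1 *m Q *m G *m (X *m P1 *m Q)^T = X *m (P1 *m H *m P1^T) *m X^T.
  by rewrite /H !trmx_mul !mulmxA.
rewrite P1H -PE; exact: erefl.
Qed.

(* An orthogonal basis of a maximal negative definite subspace. *)
Definition negative_frame n (G : 'M[int]_n) (s : seq 'rV[int]_n) : Prop :=
  [/\ pairwise (fun u v => bform G u v == 0) s,
      all (fun u => bform G u u < 0) s
    & forall v, v != 0 -> all (fun u => bform G u v == 0) s -> 0 < bform G v v].

Lemma negative_frame_exists n (G : 'M[int]_n) : is_lattice G ->
  {s : seq 'rV[int]_n | negative_frame G s}.
Proof.
move=> [sG ndG]; have [P [d nzP PG]] := diagonalize sG.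
have gE i j : bform G (row i P) (row j P) = d 0 i *+ (i == j).
  transitivity ((P *m G *m P^T) i j); last by rewrite PG mxE.
  by rewrite /bform tr_row -!row_mul !mxE; apply: eq_bigr => k _; rewrite !mxE.
have nz_d i : d 0 i != 0.
  have: \det (diag_mx d) != 0 by rewrite -PG !det_mulmx det_tr !mulf_neq0.
  by rewrite det_diag; apply: contraNneq => di0; rewrite (bigD1 i) //= di0 mul0r.
exists [seq row i P | i <- enum 'I_n & d 0 i < 0]; split.
- rewrite pairwise_map.
  apply: (subseq_pairwise (filter_subseq _ _)).
  apply: (@sub_pairwise _ (fun i j => i != j)); last first.
    by rewrite -uniq_pairwise enum_uniq.
  by move=> i j /= /negbTE nij; rewrite gE nij.
- rewrite all_map; apply/allP=> i; rewrite mem_filter => /andP[di _].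
  by rewrite /= gE eqxx.
move=> v nz_v /allP orth.
(* The adjugate replaces the inverse: [w] holds the integral coordinates of [\det P *: v] in the
   rows of [P]. Orthogonality to the frame kills those with negative [d 0 i]. *)
pose w := v *m \adj P.
have wP : w *m P = \det P *: v by rewrite -mulmxA mul_adj_mx mul_mx_scalar.
clearbody w.
have wE i : bform G (row i P) (w *m P) = d 0 i * w 0 i.
  rewrite /bform trmx_mul !mulmxA -!row_mul PG mul_diag_mx.
  by rewrite !mxE.
have w0 i : d 0 i < 0 -> w 0 i = 0.
  move=> di; have /eqP uv0 : bform G (row i P) v == 0.
    by apply/orth/map_f; rewrite mem_filter di mem_enum.
  apply/eqP; have := wE i; rewrite wP bformC // bformZl bformC // uv0 mulr0.
  by move/esym/eqP; rewrite mulf_eq0 (negbTE (nz_d i)).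
have ww : \det P ^+ 2 * bform G v v = \sum_i d 0 i * w 0 i ^+ 2.
  rewrite expr2 -mulrA -bformZl bformC // -bformZl -wP.
  rewrite /bform trmx_mul !mulmxA -(mulmxA w) -(mulmxA w) PG mul_mx_diag mxE.
  by apply: eq_bigr => i _; rewrite !mxE mulrAC mulrC -expr2.
have term_ge0 i : 0 <= d 0 i * w 0 i ^+ 2.
  have [di | di] := ltP (d 0 i) 0; last by rewrite mulr_ge0 ?sqr_ge0.
  by rewrite w0 // expr0n mulr0.
have det2_gt0 : 0 < \det P ^+ 2 by rewrite exprn_even_gt0.
rewrite -(pmulr_rgt0 _ det2_gt0) ww lt_neqAle sumr_ge0 // andbT eq_sym.
apply: contra nz_v => /eqP sum0.
have wz : w = 0.
  apply/rowP=> i; rewrite mxE; apply/eqP.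
  have /eqP : d 0 i * w 0 i ^+ 2 = 0 by apply: psumr_eq0P sum0 _ _.
  by rewrite mulf_eq0 (negbTE (nz_d i)) expf_eq0.
have : \det P *: v = 0 by rewrite -wP wz mul0mx.
by move/eqP; rewrite scalemx_eq0 (negbTE nzP).
Qed.

(** * Elimination of one negative direction *)

(** Expanding the sum of the squares of [m x_i - S], where [S] is the sum of the [x_i], gives [m]
    times the difference of the two sides. *)
Lemma cauchy_schwarz_const m (x : 'rV[int]_m) :
  (\sum_i x 0 i) ^+ 2 <= m%:R * \sum_i x 0 i ^+ 2.
Proof.
case: m x => [|m] x; first by rewrite !big_ord0.
set S := \sum_i x 0 i; set Q := \sum_i _.
have : 0 <= \sum_i (m.+1%:R * x 0 i - S) ^+ 2 by apply: sumr_ge0 => i _; apply: sqr_ge0.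
have -> : \sum_i (m.+1%:R * x 0 i - S) ^+ 2 = m.+1%:R * (m.+1%:R * Q - S ^+ 2).
  have E i : (m.+1%:R * x 0 i - S) ^+ 2 =
      m.+1%:R ^+ 2 * x 0 i ^+ 2 + (- 2%:R * m.+1%:R * S) * x 0 i + S ^+ 2 by ring.
  under eq_bigr => i _ do rewrite E.
  rewrite !big_split /= -!mulr_sumr -/S -/Q sumr_const card_ord -mulr_natl.
  ring.
by rewrite pmulr_rge0 ?ltr0Sn // subr_ge0.
Qed.

Lemma bform1 n (x y : 'rV[int]_n) : bform 1%:M x y = \sum_i x 0 i * y 0 i.
Proof. by rewrite /bform mulmx1 mxE; apply: eq_bigr => i _; rewrite mxE. Qed.

(* This is [4 D - 2] for [D = - bform G u u > 0]; the subtraction does not truncate. *)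
Definition elim_rank n (G : 'M[int]_n) (u : 'rV[int]_n) : nat :=
  (absz (4 * bform G u u)%R - 2)%N.

Definition elim_vec n (u : 'rV[int]_n) k : 'rV[int]_(n + k) :=
  row_mx (2 *: u) (const_mx 1).

Definition elim_gram n (G : 'M[int]_n) (u : 'rV[int]_n) : 'M[int]_(n + elim_rank G u) :=
  add_square (osum G 1%:M) (elim_vec u _).

Lemma elim_rankE n (G : 'M[int]_n) u :
  bform G u u < 0 -> (elim_rank G u)%:R = - (4 * bform G u u) - 2 :> int.
Proof. rewrite /elim_rank; lia. Qed.

Lemma osum1_tr n k (G : 'M[int]_n) :
  G^T = G -> (osum G (1%:M : 'M_k))^T = osum G 1%:M.
Proof. by move=> sG; rewrite osum_tr sG trmx1. Qed.

Lemma elim_stably_isometric n (G : 'M[int]_n) u :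
  G^T = G -> bform G u u < 0 -> stably_isometric G (elim_gram G u).
Proof.
move=> sG u_lt0; exists (elim_rank G u + 1)%N, (osum 1%:M 1%:M), 1%N, (-1)%:M.
rewrite osum_tr !trmx1 tr_scalar_mx osum_unitmx ?unitmx1 //; split=> //.
  by rewrite unitmxE det_scalar unitrX ?unitrN1.
apply: isometric_trans (isometric_sym (isometric_osumA _ _ _)) _.
apply: add_square_isometric; first exact: osum1_tr.
(* The norm of [elim_vec] is [4 <u,u> + (4 D - 2) = -2]. *)
rewrite bform_osum bform1 bformZl bformC // bformZl.
under eq_bigr => i _ do rewrite !mxE mulr1.
rewrite sumr_const card_ord -/(_%:R) elim_rankE //; ring.
Qed.

Lemma bform_elim n (G : 'M[int]_n) u l x l' x' : G^T = G ->
  bform (elim_gram G u) (row_mx l x) (row_mx l' x') =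
  bform G l l' + \sum_i x 0 i * x' 0 i +
    (2 * bform G u l + \sum_i x 0 i) * (2 * bform G u l' + \sum_i x' 0 i).
Proof.
move=> sG; rewrite bform_add_square; last exact: osum1_tr.
rewrite !bform_osum !bform1 !bformZl; congr (_ + (_ + _) * (_ + _)).
  by apply: eq_bigr => i _; rewrite mxE mul1r.
by apply: eq_bigr => i _; rewrite mxE mul1r.
Qed.

Lemma dvdz_mul_pred (z : int) : (2 %| z * (z - 1))%Z.
Proof.
have [Ez | Ez] : z = (z %/ 2)%Z * 2 \/ z = (z %/ 2)%Z * 2 + 1 by lia.
- by apply/dvdzP; exists ((z %/ 2)%Z * (z - 1)); rewrite {1}Ez; ring.
- by apply/dvdzP; exists (z * (z %/ 2)%Z); rewrite {2}Ez; ring.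
Qed.

(** With [S] the sum of the [x_i], both the sum of the [x_i ^+ 2] and the added square
    [(2 b + S) ^+ 2] are congruent to [S] modulo 2, so together they are even. *)
Lemma elim_even n (G : 'M[int]_n) u :
  G^T = G -> even_lattice G -> even_lattice (elim_gram G u).
Proof.
move=> sG evG v; rewrite -(hsubmxK v) bform_elim //.
have /dvdzP[a ->] := evG (lsubmx v).
set x := rsubmx v; set b := bform _ _ _.
have /dvdzP[c Ec] : (2 %| \sum_i x 0 i * x 0 i - \sum_i x 0 i)%Z.
  rewrite -sumrB; apply: rpred_sum => i _.
  by rewrite -[X in _ - X]mulr1 -mulrBr dvdz_mul_pred.
set S := \sum_i x 0 i in Ec *.
have /dvdzP[e Ee] := dvdz_mul_pred (S + 1); rewrite addrK in Ee.
apply/dvdzP; exists (a + c + e + 2 * b ^+ 2 + 2 * b * S); lia.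
Qed.

Lemma elim_negative_frame n (G : 'M[int]_n) u s :
  G^T = G -> negative_frame G (u :: s) ->
  negative_frame (elim_gram G u) [seq row_mx v 0 | v <- s].
Proof.
move=> sG [/= /andP[/allP us ss] /andP[u_lt0 /allP s_lt0] pos].
have s0 k : \sum_(i < k) (0 : 'rV[int]_k) 0 i = 0.
  by apply: big1 => i _; rewrite mxE.
(* The added square contributes nothing here, since [(v, 0)] pairs with [elim_vec] to
   [2 <u,v> = 0]. *)
have bE v w (y : 'rV_(elim_rank G u)) : v \in s -> 
    bform (elim_gram G u) (row_mx v 0) (row_mx w y) = bform G v w.
  move=> /us /eqP uv; rewrite bform_elim // uv s0 mulr0 addr0 mul0r addr0.
  by rewrite big1 ?addr0 // => i _; rewrite mxE mul0r.
split.
- rewrite pairwise_map; apply: sub_in_pairwise (allss s) ss => v w vs ws.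
  by rewrite /= bE.
- by rewrite all_map; apply/allP=> v vs; rewrite /= bE ?s_lt0.
move=> v; rewrite -(hsubmxK v); move: (lsubmx v) (rsubmx v) => l x nz_v.
rewrite all_map => /allP orth; rewrite bform_elim //.
have {}orth w : w \in s -> bform G w l = 0.
  by move=> ws; apply/eqP; have := orth w ws; rewrite /= bE.
set a := bform G l l; set b := bform G u l; set D := - bform G u u.
set S := \sum_i x 0 i; set y := 2 * b + S.
under eq_bigr do rewrite -expr2.
set Q := \sum_i _.
have D_gt0 : 0 < D by rewrite oppr_gt0.
have Q_ge0 : 0 <= Q by apply: sumr_ge0 => i _; apply: sqr_ge0.
(* The vector [t] is [D] times the projection of [l] orthogonal to [u]; it is orthogonal to the
   whole old frame, so its norm cannot be negative. *)
have ortho_pos : 0 <= D * a + b ^+ 2.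
  pose t := D *: l + b *: u.
  have ut : bform G u t = 0.
    by rewrite bformC // bformDl !bformZl bformC // -/b /D; ring.
  have tt : bform G t t = D * (D * a + b ^+ 2).
    rewrite {1}/t bformDl !bformZl ut bformC // bformDl !bformZl.
    by rewrite -/a -/b; ring.
  have [t0 | nz_t] := eqVneq t 0.
    suff : D * (D * a + b ^+ 2) = 0 by nia.
    by rewrite -tt t0 /bform !mul0mx mxE.
  have : 0 < bform G t t.
    apply: pos => //=; rewrite ut eqxx /=; apply/allP=> w ws.
    rewrite bformC // bformDl !bformZl !(bformC _ w) //.
    by rewrite orth // bformC // (eqP (us _ ws)) !mulr0 addr0.
  by rewrite tt pmulr_rgt0 // => /ltW.
(* The [4 D - 1] numbers [x_i] and [-y] add up to [-2 b]. *)
have cs : (2 * b) ^+ 2 <= (4 * D - 1) * (Q + y ^+ 2).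
  have := cauchy_schwarz_const (row_mx x (- y)%:M).
  rewrite !big_split_ord /= !big_ord1.
  under eq_bigr do rewrite row_mxEl.
  under [in X in _ <= X]eq_bigr do rewrite row_mxEl.
  rewrite !row_mxEr !mxE mulr1n -/S -/Q natrD elim_rankE //.
  by rewrite /y /D; lia.
(* Put [E = Q + y ^+ 2]; the norm in question is [a + E]. From [a >= - b^2 / D] and
   [4 b^2 <= (4 D - 1) E] it is at least [E / (4 D)]: it matters that [4 D - 1] is less than [4 D].
   If [E = 0], then [x] and [b] vanish and [l] is orthogonal to the old frame. *)
have [E_gt0 | ] := ltP 0 (Q + y ^+ 2); first by nia.
move=> E_le0; have y_ge0 := sqr_ge0 y.
have Q0 : Q = 0 by lia.
have y0 : y = 0 by nia.
have x0 : x = 0.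
  apply/rowP=> i; rewrite mxE; apply/eqP.
  have /eqP : x 0 i ^+ 2 = 0 by apply: psumr_eq0P Q0 _ _ => // j _; apply: sqr_ge0.
  by rewrite expf_eq0.
have S0 : S = 0 by rewrite /S x0 s0.
have b0 : b = 0 by move: y0; rewrite /y S0; lia.
rewrite Q0 y0 mulr0 !addr0; apply: pos.
  by apply: contra nz_v => /eqP ->; rewrite x0 row_mx0.
by rewrite /= -/b b0 eqxx; apply/allP=> w ws; rewrite orth.
Qed.

(** * The iteration and the algorithm *)

(** Induction on the length of the frame: each elimination drops its head, and an empty frame means
    that the form is positive definite. *)
Lemma negative_frame_reduce n (G : 'M[int]_n) s : G^T = G -> negative_frame G s ->
  {mH : {m : nat & 'M[int]_m} |
    [/\ is_lattice (projT2 mH), even_lattice G -> even_lattice (projT2 mH),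
        pos_def (projT2 mH) & stably_isometric G (projT2 mH)]}.
Proof.
move: {2}(size s) (erefl (size s)) => k.
elim: k n G s => [|k IHk] n G [|u s] //=; [move=> _ | move=> [size_s]] => sG frG.
  have posG : pos_def G by case: frG => _ _ pos v nz_v; apply: pos.
  exists (existT (fun m => 'M[int]_m) n G); split=> //=; last exact: stably_isometric_refl.
  (* Non-degeneracy is recovered from positivity: a nonzero kernel vector would have norm 0. *)
  split=> //; apply/det0P => -[v nz_v vG0].
  by have := posG v nz_v; rewrite /bform vG0 mul0mx mxE ltxx.
have u_lt0 : bform G u u < 0 by case: frG => _ /andP[].
have sG' : (elim_gram G u)^T = elim_gram G u by apply/add_square_tr/osum1_tr.
have [|mH [latH evH posH GH]] := IHk _ _ _ _ sG' (elim_negative_frame sG frG).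
  by rewrite size_map.
exists mH; split=> // [evG|]; first exact/evH/elim_even.
exact: stably_isometric_trans (elim_stably_isometric sG u_lt0) GH.
Qed.

Theorem theorem1p2 :
  { f : forall n : nat, 'M[int]_n -> { m : nat & 'M[int]_m } |
    forall (n : nat) (G : 'M[int]_n),
      is_lattice G -> even_lattice G ->
      [/\ is_lattice (projT2 (f n G)),
          even_lattice (projT2 (f n G)),
          pos_def (projT2 (f n G))
        & exists (k1 : nat) (U1 : 'M[int]_k1) (k2 : nat) (U2 : 'M[int]_k2),
            [/\ is_lattice U1, unimodular U1, is_lattice U2, unimodular U2
              & isometric (osum G U1) (osum (projT2 (f n G)) U2)]] }.
Proof.
suff F n (G : 'M[int]_n) : {mH : {m : nat & 'M[int]_m} | is_lattice G ->
    [/\ is_lattice (projT2 mH), even_lattice G -> even_lattice (projT2 mH),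
        pos_def (projT2 mH) & stably_isometric G (projT2 mH)]}.
  have unit_lattice k (U : 'M[int]_k) : U^T = U -> U \in unitmx -> is_lattice U.
    move=> sU uU; split=> //; move: uU; rewrite unitmxE /nondegenerate.
    by apply: contraTneq => ->; rewrite unitr0.
  exists (fun n G => sval (F n G)) => n G latG evG.
  have [latH evH posH] := svalP (F n G) latG.
  move=> [k1 [U1 [k2 [U2 [sU1 uU1 sU2 uU2 GH]]]]]; split=> //; first exact: evH.
  exists k1, U1, k2, U2; split.
  - exact: unit_lattice.
  - exact: unitmx_unimodular.
  - exact: unit_lattice.
  - exact: unitmx_unimodular.
  exact: GH.
(* The function must be total on integer matrices, so the lattice conditions are decided by a
   Boolean test; a matrix that fails it is returned unchanged. *)
have [/andP[/eqP sG ndG] | notG] := boolP ((G^T == G) && (\det G != 0)).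
  have [s frG] := negative_frame_exists (conj sG ndG).
  by have [mH HH] := negative_frame_reduce sG frG; exists mH.
by exists (existT (fun m => 'M[int]_m) n G) => -[sG ndG]; rewrite sG eqxx ndG in notG.
Qed.
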